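(* Let $\mathfrak g=\mathfrak{so}(N)$, $N=2n$, $m\in\mathbb N$, $m\le n$, $i'=N+1-i$, and let $$A=\pm\Bigl(\sum_{i=1}^m q^{-m}(1-q^{-N+2m})e_{ii}+\sum_{m<i<m'}q^{-m}e_{ii}+\sum_{i\le m\text{ or }i'\le m}y_ie_{ii'}\Bigr),\qquad y_iy_{i'}=q^{-N}.$$ Let $\Pi_{\mathfrak l}=\{\alpha_i\}_{i=m+1}^n$ if $m\le n-2$ and $\Pi_{\mathfrak l}=\varnothing$ if $m\ge n-1$. Let $U_q(\mathfrak k)\subset U_q(\mathfrak g)$ be the subalgebra generated by $e_i,f_i,q^{\pm h_i}$ with $\alpha_i\in\Pi_{\mathfrak l}$, and by $X_{\alpha_i}=q^{h_{\tilde\alpha_i}-h_{\alpha_i}}e_i+c_{\alpha_i}F_{\tilde\alpha_i}$, $q^{\pm(h_{\tilde\alpha_i}-h_{\alpha_i})}$ with $\alpha_i\notin\Pi_{\mathfrak l}$, with the following data: • for $i<m$: $\tilde\alpha_i=\alpha_i$, $F_{\tilde\alpha_i}=F_i$, $c_{\alpha_i}=-\dfrac{q\,y_{i+1}}{y_i}$; • if $m=n$: $\tilde\alpha_n=\alpha_n$, $F_{\tilde\alpha_n}=F_n$, $c_{\alpha_n}=-\dfrac{1}{y_{n-1}y_nq^{2n-1}}$; • if $m=n-1$: $\tilde\alpha_{n-1}=\alpha_n$, $\tilde\alpha_n=\alpha_{n-1}$, $F_{\tilde\alpha_{n-1}}=F_n$, $F_{\tilde\alpha_n}=F_{n-1}$,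 $c_{\alpha_{n-1}}=c_{\alpha_n}=-\dfrac{1}{y_{n-1}q^n}$; • if $m\le n-2$: $\tilde\alpha_m=\alpha_m+2\sum_{l=m+1}^{n-2}\alpha_l+\alpha_{n-1}+\alpha_n$, $c_{\alpha_m}=\dfrac{(-1)^{n-m}}{y_mq^{m+1}}$, and $$F_{\tilde\alpha_m}=[\dots[[\dots[[F_m,F_{m+1}]_q,F_{m+2}]_q,\dots,F_n]_q,F_{n-2}]_q,\dots,F_{m+1}]_q\quad(m<n-2),$$ $$F_{\tilde\alpha_m}=[[F_{n-2},F_{n-1}]_q,F_n]_q\quad(m=n-2).$$ Then $U_q(\mathfrak k)$ leaves $A$ fixed: $\pi(x)A=A\pi(x)$ for all $x\in U_q(\mathfrak k)$, where $\pi$ is the natural representation of $U_q(\mathfrak g)$ on $\mathbb C^N$.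
   Context: $q\in\mathbb C$ is nonzero and not a root of unity; $\mathfrak{so}(2n)$ is assumed simple. $U_q(\mathfrak{so}(2n))$ has generators $e_i,f_i,q^{\pm h_i}$, $1\le i\le n$, for the simple roots $\alpha_i=\varepsilon_i-\varepsilon_{i+1}$ ($i<n$), $\alpha_n=\varepsilon_{n-1}+\varepsilon_n$, $(\varepsilon_i,\varepsilon_j)=\delta_{ij}$: $q^{h_i}e_jq^{-h_i}=q^{(\alpha_i,\alpha_j)}e_j$, $q^{h_i}f_jq^{-h_i}=q^{-(\alpha_i,\alpha_j)}f_j$, $[e_i,f_j]=\delta_{ij}\frac{q^{h_i}-q^{-h_i}}{q-q^{-1}}$, the $q^{\pm h_i}$ commute, plus the quantum Serre relations. For $\beta=\sum k_i\alpha_i$, $q^{h_\beta}=\prod_i(q^{h_i})^{k_i}$. Notation: $F_i=q^{h_i}f_i$, $[x,y]_a=xy-a\,yx$. With matrix units $e_{jk}$ (two indices), the natural representation $\pi:U_q(\mathfrak g)\to\mathrm{End}(\mathbb C^N)$ is, for $i<n$: $e_i\mapsto e_{i,i+1}-e_{(i+1)',i'}$, $f_i\mapsto e_{i+1,i}-e_{i',(i+1)'}$, $q^{h_i}\mapsto\sum_jq^{\delta_{ji}-\delta_{ji'}-\delta_{j,i+1}+\delta_{j,(i+1)'}}e_{jj}$; and $e_n\mapsto e_{n-1,n+1}-e_{(n+1)',(n-1)'}$, $f_n\mapsto e_{n+1,n-1}-e_{(n-1)',(n+1)'}$, $q^{h_n}\mapsto\sum_jq^{\delta_{j,n-1}-\delta_{j,(n-1)'}+\delta_{jn}-\delta_{jn'}}e_{jj}$.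 *)

(* Defs.v *)
From HB Require Import structures.
From mathcomp Require Import all_boot all_order all_algebra.
From mathcomp Require Import boolp reals zify ring.
From mathcomp.finmap Require Import finmap.
From mathcomp.real_closed Require Import complex.
From mathcomp.multinomials Require Import monalg.

Set Implicit Arguments.
Unset Strict Implicit.
Unset Printing Implicit Defensive.

Import Order.TTheory GRing.Theory Num.Theory.
Local Open Scope ring_scope.
Local Open Scope quotient_scope.

(* Quotient of an algebra by the two-sided ideal generated by S.  The carrier
   is given a (possibly zero) ring and a K-module structure. *)

Inductive ideal_gen (A : pzRingType) (S : A -> Prop) : A -> Prop :=
| ideal_gen0 : ideal_gen S 0
| ideal_genD a r b x : S r -> ideal_gen S x -> ideal_gen S (a * r * b + x).

Section Ideal.
Variables (A : pzRingType) (S : A -> Prop).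

Lemma ideal_gen_add x y : ideal_gen S x -> ideal_gen S y -> ideal_gen S (x + y).
Proof.
elim=> [|a r b z Sr _ IH] Iy; first by rewrite add0r.
by rewrite -addrA; apply: ideal_genD => //; apply: IH.
Qed.

Lemma ideal_gen_opp x : ideal_gen S x -> ideal_gen S (- x).
Proof.
elim=> [|a r b z Sr _ IH]; first by rewrite oppr0; constructor.
by rewrite opprD -!mulNr; constructor.
Qed.

Lemma ideal_gen_mulr c x : ideal_gen S x -> ideal_gen S (x * c).
Proof.
elim=> [|a r b z Sr _ IH]; first by rewrite mul0r; constructor.
by rewrite mulrDl -mulrA; constructor.
Qed.

Lemma ideal_gen_mull c x : ideal_gen S x -> ideal_gen S (c * x).
Proof.
elim=> [|a r b z Sr _ IH]; first by rewrite mulr0; constructor.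
by rewrite mulrDr !mulrA; constructor.
Qed.

Lemma ideal_gen_in r : S r -> ideal_gen S r.
Proof.
by move=> Sr; rewrite -[r]addr0 -[r]mulr1 -[r]mul1r; constructor=> //; constructor.
Qed.

Definition idealp : A -> bool := fun x => `[< ideal_gen S x >].

Lemma idealpP x : reflect (ideal_gen S x) (x \in idealp).
Proof. exact: asboolP. Qed.

Lemma idealp_zmod_closed : zmod_closed idealp.
Proof.
split=> [|x y /idealpP Ix /idealpP Iy]; first by apply/idealpP; constructor.
by apply/idealpP/ideal_gen_add => //; apply: ideal_gen_opp.
Qed.

HB.instance Definition _ := GRing.isZmodClosed.Build A idealp idealp_zmod_closed.
Definition ideal_zmod : zmodClosed A := GRing.ZmodClosed.clone A idealp _.

End Ideal.

Section QuotientAlgebra.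
Variables (K : comNzRingType) (A : lalgType K) (S : A -> Prop).

Definition quot_alg : Type := Quotient.quot (ideal_zmod S).
HB.instance Definition _ := GRing.Zmodule.on quot_alg.
HB.instance Definition _ := EqQuotient.on quot_alg.

Definition to_quot (x : A) : quot_alg := \pi_quot_alg x.

Lemma to_quotP x y : to_quot x = to_quot y <-> ideal_gen S (x - y).
Proof.
rewrite /to_quot; split=> [/eqP|/idealpP I].
  by rewrite -(Quotient.idealrBE (ideal_zmod S)) => /idealpP.
by apply/eqP; rewrite -(Quotient.idealrBE (ideal_zmod S)).
Qed.

Lemma to_quotK (x : quot_alg) : to_quot (repr x) = x.
Proof. exact: reprK. Qed.

Lemma repr_to_quot x : ideal_gen S (repr (to_quot x) - x).
Proof. by apply/to_quotP; rewrite to_quotK. Qed.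

Lemma to_quotB : {morph to_quot : x y / x - y}.
Proof. by move=> x y; rewrite /to_quot -[x - y]/(x - y) !piE. Qed.

HB.instance Definition _ :=
  GRing.isZmodMorphism.Build A quot_alg to_quot to_quotB.

Definition quot_one : quot_alg := to_quot 1.
Definition quot_mul (x y : quot_alg) : quot_alg := to_quot (repr x * repr y).
Definition quot_scale (c : K) (x : quot_alg) : quot_alg := to_quot (c *: repr x).

Lemma to_quotM x y : to_quot (x * y) = quot_mul (to_quot x) (to_quot y).
Proof.
apply/esym/to_quotP; set x' := repr _; set y' := repr _.
rewrite -[x' * y'](subrK (x' * y)) -addrA -mulrBr -mulrBl.
apply: ideal_gen_add; [apply: ideal_gen_mull|apply: ideal_gen_mulr];
  exact: repr_to_quot.
Qed.

Lemma to_quotZ c x : to_quot (c *: x) = quot_scale c (to_quot x).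
Proof.
apply/esym/to_quotP; rewrite -scalerBr -mulr_algl.
exact/ideal_gen_mull/repr_to_quot.
Qed.

Fact quot_mulA : associative quot_mul.
Proof.
by move=> x y z; rewrite -[x]to_quotK -[y]to_quotK -[z]to_quotK -!to_quotM mulrA.
Qed.
Fact quot_mul1 : left_id quot_one quot_mul.
Proof. by move=> x; rewrite -[x]to_quotK -to_quotM mul1r. Qed.
Fact quot_mulr1 : right_id quot_one quot_mul.
Proof. by move=> x; rewrite -[x]to_quotK -to_quotM mulr1. Qed.
Fact quot_mulDl : left_distributive quot_mul +%R.
Proof.
move=> x y z; rewrite -[x]to_quotK -[y]to_quotK -[z]to_quotK.
by rewrite -raddfD -!to_quotM mulrDl raddfD.
Qed.
Fact quot_mulDr : right_distributive quot_mul +%R.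
Proof.
move=> x y z; rewrite -[x]to_quotK -[y]to_quotK -[z]to_quotK.
by rewrite -raddfD -!to_quotM mulrDr raddfD.
Qed.

HB.instance Definition _ := GRing.Zmodule_isPzRing.Build quot_alg
  quot_mulA quot_mul1 quot_mulr1 quot_mulDl quot_mulDr.

Fact to_quot_monoid : monoid_morphism to_quot.
Proof. by split=> // x y; rewrite to_quotM. Qed.
HB.instance Definition _ :=
  GRing.isMonoidMorphism.Build A quot_alg to_quot to_quot_monoid.

Fact quot_scaleA a b x : quot_scale a (quot_scale b x) = quot_scale (a * b) x.
Proof. by rewrite -[x]to_quotK -!to_quotZ scalerA. Qed.
Fact quot_scale1 : left_id 1 quot_scale.
Proof. by move=> x; rewrite -[x]to_quotK -to_quotZ scale1r. Qed.
Fact quot_scaleDr : right_distributive quot_scale +%R.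
Proof.
move=> a x y; rewrite -[x]to_quotK -[y]to_quotK.
by rewrite -raddfD -!to_quotZ scalerDr raddfD.
Qed.
Fact quot_scaleDl x : {morph quot_scale^~ x : a b / a + b}.
Proof.
by move=> a b; rewrite -[x]to_quotK -!to_quotZ scalerDl raddfD.
Qed.

HB.instance Definition _ := GRing.Zmodule_isLmodule.Build K quot_alg
  quot_scaleA quot_scale1 quot_scaleDr quot_scaleDl.

Fact to_quot_scalable : scalable to_quot.
Proof. exact: to_quotZ. Qed.
HB.instance Definition _ :=
  GRing.isScalable.Build K A quot_alg *:%R to_quot to_quot_scalable.

Lemma quot_scaleAl c (x y : quot_alg) : c *: (x * y) = (c *: x) * y.
Proof.
rewrite -[LHS]/(quot_scale c (quot_mul x y)) -[RHS]/(quot_mul (quot_scale c x) y).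
by rewrite -[x]to_quotK -[y]to_quotK -!(to_quotM, to_quotZ) scalerAl.
Qed.

End QuotientAlgebra.

(* {malg K[{fmonom I}]} is the free associative K-algebra on I.  A family of
   matrices indexed by I which satisfies the relations S induces a
   representation of the quotient. *)

Section MatrixRepresentation.
Local Open Scope fset_scope.
Variables (K : comNzRingType) (I : choiceType) (N : nat) (h : I -> 'M[K]_N).
Implicit Types (g : {malg K[{fmonom I}]}) (w : {fmonom I}).

Definition word_mx w : 'M[K]_N := \prod_(i <- fmonom_val w) h i.

Definition free_eval g : 'M[K]_N := \sum_(w <- msupp g) g@_w *: word_mx w.

Lemma word_mx1 : word_mx mone = 1.
Proof. by rewrite /word_mx fm1 big_nil. Qed.

Lemma word_mxM w1 w2 : word_mx (mmul w1 w2) = word_mx w1 * word_mx w2.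
Proof. by rewrite /word_mx fmM big_cat. Qed.

Lemma free_evalEw (d : {fset {fmonom I}}) g :
  msupp g `<=` d -> free_eval g = \sum_(w <- d) g@_w *: word_mx w.
Proof.
move=> le; rewrite /free_eval (big_fset_incl _ le) // => w _ /mcoeff_outdom ->.
by rewrite scale0r.
Qed.

Fact free_eval_zmod : zmod_morphism free_eval.
Proof.
move=> g1 g2; set E := msupp g1 `|` msupp g2 `|` msupp (g1 - g2).
have sub g : msupp g `<=` E -> free_eval g = \sum_(w <- E) g@_w *: word_mx w.
  exact: free_evalEw.
rewrite (sub g1) ?(sub g2) ?(sub (g1 - g2)) /E ?fsubsetUr //; last 2 first.
- by rewrite -fsetUA fsetUCA fsubsetUl.
- by rewrite -fsetUA fsubsetUl.
by rewrite -sumrB; apply/eq_bigr=> k _; rewrite raddfB /= scalerBl.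
Qed.
HB.instance Definition _ := GRing.isZmodMorphism.Build _ _ free_eval free_eval_zmod.

Fact free_evalZ : scalable free_eval.
Proof.
move=> c g; rewrite (free_evalEw (msuppZ_le c g)) scaler_sumr.
by apply: eq_bigr => w _; rewrite mcoeffZ scalerA.
Qed.
HB.instance Definition _ :=
  GRing.isScalable.Build K _ _ *:%R free_eval free_evalZ.

Lemma free_evalU c w : free_eval << c *g w >> = c *: word_mx w.
Proof. by rewrite (free_evalEw msuppU_le) big_seq_fset1 mcoeffUU. Qed.

Lemma free_eval_gen i : free_eval << fmu i >> = h i.
Proof. by rewrite free_evalU scale1r /word_mx fmuE big_seq1. Qed.

Fact free_eval_monoid : monoid_morphism free_eval.
Proof.
split=> [|g1 g2]; first by rewrite free_evalU scale1r word_mx1.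
rewrite malgME raddf_sum mulr_suml /=; apply: eq_bigr => w1 _.
rewrite raddf_sum mulr_sumr /=; apply: eq_bigr => w2 _.
rewrite free_evalU word_mxM -[LHS]/(_ *: (_ *m _)) -[RHS]/(_ *m _).
by rewrite -scalemxAl -scalemxAr scalerA.
Qed.
HB.instance Definition _ :=
  GRing.isMonoidMorphism.Build _ _ free_eval free_eval_monoid.

Variable S : {malg K[{fmonom I}]} -> Prop.

Definition quot_rep of (forall r, S r -> free_eval r = 0) :
  quot_alg S -> 'M[K]_N := fun x => free_eval (repr x).

Hypothesis hS : forall r, S r -> free_eval r = 0.

Lemma quot_repE g : quot_rep hS (to_quot S g) = free_eval g.
Proof.
apply/eqP; rewrite -subr_eq0 -raddfB; apply/eqP.
elim: (repr_to_quot S g) => [|a r b x Sr _ IH]; first exact: raddf0.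
by rewrite raddfD /= !rmorphM /= IH (hS Sr) mulr0 mul0r addr0.
Qed.

Fact quot_rep_zmod : zmod_morphism (quot_rep hS).
Proof.
move=> x y; rewrite -[x]to_quotK -[y]to_quotK -raddfB !quot_repE.
exact: raddfB.
Qed.
HB.instance Definition _ :=
  GRing.isZmodMorphism.Build _ _ (quot_rep hS) quot_rep_zmod.

Fact quot_rep_scalable : scalable (quot_rep hS).
Proof.
move=> c x; rewrite -[x]to_quotK -linearZ !quot_repE; exact: linearZ.
Qed.
HB.instance Definition _ :=
  GRing.isScalable.Build K _ _ *:%R (quot_rep hS) quot_rep_scalable.

Fact quot_rep_monoid : monoid_morphism (quot_rep hS).
Proof.
split=> [|x y]; first by rewrite -(rmorph1 (to_quot S)) quot_repE rmorph1.
by rewrite -[x]to_quotK -[y]to_quotK -rmorphM !quot_repE rmorphM.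
Qed.
HB.instance Definition _ :=
  GRing.isMonoidMorphism.Build _ _ (quot_rep hS) quot_rep_monoid.

End MatrixRepresentation.

(* The quantum group of so(2n), by generators and relations.  Nodes of the
   Dynkin diagram are numbered from 1 to n. *)

Definition node (n : nat) : choiceType := {i : nat | (0 < i <= n)%N}.

Inductive Uq_gen (n : nat) : Type :=
| Ge of node n | Gf of node n | Gk of node n | Gkinv of node n.

Section GenChoice.
Variable n : nat.
Let code : Type := ((node n + node n) + (node n + node n))%type.
Definition Uq_gen_code (g : Uq_gen n) : code := match g with
  | Ge i => inl (inl i) | Gf i => inl (inr i)
  | Gk i => inr (inl i) | Gkinv i => inr (inr i) end.
Definition Uq_gen_decode (c : code) : Uq_gen n := match c with
  | inl (inl i) => Ge i | inl (inr i) => Gf i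
  | inr (inl i) => Gk i | inr (inr i) => Gkinv i end.
Lemma Uq_gen_codeK : cancel Uq_gen_code Uq_gen_decode.
Proof. by case. Qed.
HB.instance Definition _ := Choice.copy (Uq_gen n) (can_type Uq_gen_codeK).
End GenChoice.

(* [alpha n i k] is the coordinate of the simple root alpha_i on epsilon_k. *)
Definition alpha (n i k : nat) : int :=
  if (i < n)%N then (k == i)%:Z - (k == i.+1)%:Z
  else (k == n.-1)%:Z + (k == n)%:Z.

Definition root_form (n i j : nat) : int :=
  \sum_(1 <= k < n.+1) alpha n i k * alpha n j k.

Section QuantumGroup.
Variables (K : fieldType) (n : nat) (q : K).

Local Notation free := {malg K[{fmonom (Uq_gen n)}]}.
Local Notation fgen g := (<< fmu g >> : free).
Local Notation xe i := (fgen (Ge i)).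
Local Notation xf i := (fgen (Gf i)).
Local Notation xk i := (fgen (Gk i)).
Local Notation xk' i := (fgen (Gkinv i)).

(* The type D_n is simply laced, so the quantum Serre relations are
   those for (alpha_i, alpha_j) = 0 and (alpha_i, alpha_j) = -1. *)
Inductive Uq_rel : free -> Prop :=
| rel_kkinv i : Uq_rel (xk i * xk' i - 1)
| rel_kinvk i : Uq_rel (xk' i * xk i - 1)
| rel_kk i j : Uq_rel (xk i * xk j - xk j * xk i)
| rel_ke i j :
    Uq_rel (xk i * xe j * xk' i - q ^ root_form n (val i) (val j) *: xe j)
| rel_kf i j :
    Uq_rel (xk i * xf j * xk' i - q ^ (- root_form n (val i) (val j)) *: xf j)
| rel_ef i j :
    Uq_rel (xe i * xf j - xf j * xe i
            - ((i == j)%:R / (q - q^-1)) *: (xk i - xk' i))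
| rel_ee0 i j : root_form n (val i) (val j) = 0 ->
    Uq_rel (xe i * xe j - xe j * xe i)
| rel_ee1 i j : root_form n (val i) (val j) = -1 ->
    Uq_rel (xe i ^+ 2 * xe j - (q + q^-1) *: (xe i * xe j * xe i)
            + xe j * xe i ^+ 2)
| rel_ff0 i j : root_form n (val i) (val j) = 0 ->
    Uq_rel (xf i * xf j - xf j * xf i)
| rel_ff1 i j : root_form n (val i) (val j) = -1 ->
    Uq_rel (xf i ^+ 2 * xf j - (q + q^-1) *: (xf i * xf j * xf i)
            + xf j * xf i ^+ 2).

Definition Uq := quot_alg Uq_rel.
HB.instance Definition _ := GRing.PzRing.on Uq.
HB.instance Definition _ := GRing.Lmodule.on Uq.

(* The generators of Uq indexed by all natural numbers; the value is 0 when the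
   index is not in {1, ..., n}. *)
Definition Uq_at (G : node n -> Uq_gen n) (i : nat) : Uq :=
  if insub i is Some j then to_quot Uq_rel (fgen (G j)) else 0.
Definition Uq_e := Uq_at (@Ge n).
Definition Uq_f := Uq_at (@Gf n).
Definition Uq_k := Uq_at (@Gk n).
Definition Uq_kinv := Uq_at (@Gkinv n).

End QuantumGroup.

(* The natural representation.  Indices of matrix units are numbered from 1. *)

(* e_i = E_{a,b} - E_{b',a'} and f_i = E_{b,a} - E_{a',b'} for a = lo i and
   b = hi i. *)
Definition lo (n i : nat) : nat := if (i < n)%N then i else n.-1.
Definition hi (n i : nat) : nat := if (i < n)%N then i.+1 else n.+1.

Ltac decide_eqs := repeat match goal with
  | |- context [@eq_op _ ?x ?y] => first
     [ have -> : (x == y) = false by lia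
     | have -> : (x == y) = true by lia
     | case: (eqVneq x y) => ? ]
  end.

Section NaturalRepresentation.
Variables (K : fieldType) (n : nat) (q : K).
Local Notation N := n.*2.

Definition bar (i : nat) : nat := N.+1 - i.

Definition munit (i j : nat) : 'M[K]_N :=
  \matrix_(a, b) ((a.+1 == i) && (b.+1 == j))%:R.

Definition nat_e (i : nat) : 'M[K]_N :=
  if (i < n)%N then munit i i.+1 - munit (bar i.+1) (bar i)
  else munit n.-1 n.+1 - munit (bar n.+1) (bar n.-1).

Definition nat_f (i : nat) : 'M[K]_N :=
  if (i < n)%N then munit i.+1 i - munit (bar i) (bar i.+1)
  else munit n.+1 n.-1 - munit (bar n.-1) (bar n.+1).

Definition nat_wt (i j : nat) : int :=
  if (i < n)%N
  then (j == i)%:Z - (j == bar i)%:Z - (j == i.+1)%:Z + (j == bar i.+1)%:Z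
  else (j == n.-1)%:Z - (j == bar n.-1)%:Z + (j == n)%:Z - (j == bar n)%:Z.

Definition nat_diag (d : nat -> int) : 'M[K]_N :=
  \sum_(1 <= j < N.+1) q ^ d j *: munit j j.
Definition nat_k (i : nat) : 'M[K]_N := nat_diag (nat_wt i).
Definition nat_kinv (i : nat) : 'M[K]_N := nat_diag (fun j => - nat_wt i j).

Definition nat_gen (g : Uq_gen n) : 'M[K]_N := match g with
  | Ge i => nat_e (val i) | Gf i => nat_f (val i)
  | Gk i => nat_k (val i) | Gkinv i => nat_kinv (val i) end.

Local Notation lo := (lo n).
Local Notation hi := (hi n).
Local Notation E := munit.

Lemma nat_eE i : nat_e i = E (lo i) (hi i) - E (bar (hi i)) (bar (lo i)).
Proof. by rewrite /nat_e /lo /hi; case: ifP. Qed.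

Lemma munit_tr i j : (E i j)^T = E j i.
Proof. by apply/matrixP=> a b; rewrite !mxE andbC. Qed.

Lemma nat_f_tr i : nat_f i = (nat_e i)^T.
Proof.
by rewrite /nat_e /nat_f; case: ifP => _; rewrite linearB /= !munit_tr.
Qed.

Lemma munitM a b c d : (0 < b <= N)%N -> E a b * E c d = (b == c)%:R *: E a d.
Proof.
move=> /andP[b0 bN]; have bK : b.-1.+1 = b by lia.
have ltb : (b.-1 < N)%N by lia.
apply/matrixP=> x y; rewrite !mxE (bigD1 (Ordinal ltb)) //= big1 => [|z /eqP nz].
  rewrite !mxE /= bK eqxx andbT addr0 -!natrM; congr (_%:R); lia.
rewrite !mxE; have -> : (z.+1 == b) = false; last by rewrite andbF mul0r.
apply/eqP=> zb; apply: nz; apply/val_inj => /=; lia.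
Qed.

Lemma nat_diagE d : nat_diag d = diag_mx (\row_j q ^ d j.+1).
Proof.
apply/matrixP=> x y; rewrite /nat_diag summxE big_add1 big_mkord !mxE.
rewrite (bigD1 x) //= big1 => [|z /eqP nz].
  rewrite !mxE /= eqxx /= addr0 eqSS eq_sym mulr_natr.
  by congr (_ *+ _).
rewrite !mxE; have -> : (x.+1 == z.+1) = false; last by rewrite mulr0.
by apply/eqP=> -[xz]; apply: nz; apply: val_inj.
Qed.

Hypotheses (hn : (2 < n)%N) (hq0 : q != 0) (hq2 : q ^+ 2 != 1).

Lemma nat_diagM d d' : nat_diag d * nat_diag d' = nat_diag (fun j => d j + d' j).
Proof.
rewrite !nat_diagE -[_ * _]/(_ *m _) mulmx_diag; congr diag_mx.
by apply/rowP=> j; rewrite !mxE expfzDr.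
Qed.

Lemma nat_diag0 d : (forall j, d j = 0) -> nat_diag d = 1.
Proof.
move=> d0; rewrite nat_diagE; apply/matrixP=> x y; rewrite !mxE d0 expr0z.
by case: (x == y).
Qed.

Lemma eq_nat_diag d d' : d =1 d' -> nat_diag d = nat_diag d'.
Proof. by move=> e; apply: eq_bigr => j _; rewrite e. Qed.

Lemma nat_diag_conj d d' i j :
  nat_diag d * E i j * nat_diag d' = (q ^ (d i + d' j)) *: E i j.
Proof.
rewrite !nat_diagE -[_ * _]/(_ *m _ *m _) mul_diag_mx mul_mx_diag.
apply/matrixP=> x y; rewrite !mxE expfzDr //.
case: eqP => [->|_]; case: eqP => [->|_] /=; rewrite ?mulr0 ?mul0r //.
by rewrite !mulr1.
Qed.

Let pairdelta (f : nat -> int) a : (0 < a <= n)%N ->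
  \sum_(1 <= k < n.+1) f k * (k == a)%:Z = f a.
Proof.
move=> ha; rewrite (bigD1_seq a) ?mem_index_iota ?iota_uniq //=.
by rewrite eqxx mulr1 big1 ?addr0 // => k /negbTE->; rewrite mulr0.
Qed.

Lemma root_formE i j : (0 < i <= n)%N -> (0 < j <= n)%N ->
  root_form n i j = if (j < n)%N then alpha n i j - alpha n i j.+1
                    else alpha n i n.-1 + alpha n i n.
Proof.
move=> hi' hj; rewrite /root_form.
have -> : \sum_(1 <= k < n.+1) alpha n i k * alpha n j k =
  \sum_(1 <= k < n.+1) (if (j < n)%N then
     alpha n i k * (k == j)%:Z - alpha n i k * (k == j.+1)%:Z
   else alpha n i k * (k == n.-1)%:Z + alpha n i k * (k == n)%:Z).
  by apply: eq_bigr => k _; rewrite {2}/alpha; case: ifP => _; rewrite ?mulrBr ?mulrDr.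
case: ifP => jn; first by rewrite sumrB !pairdelta //; lia.
by rewrite big_split /= !pairdelta //; lia.
Qed.

Lemma root_form_wt i j : (0 < i <= n)%N -> (0 < j <= n)%N ->
  root_form n i j = nat_wt i (lo j) - nat_wt i (hi j) /\
  root_form n i j = nat_wt i (bar (hi j)) - nat_wt i (bar (lo j)).
Proof.
move=> hi' hj; rewrite root_formE // /nat_wt /alpha /lo /hi /bar.
by split; case: ifP => ?; case: ifP => ?; decide_eqs.
Qed.

End NaturalRepresentation.

Section EvalRelations.
Variables (K : fieldType) (F : lalgType K) (N : nat) (phi : F -> 'M[K]_N).
Hypotheses (phi_add : zmod_morphism phi) (phi_mul : monoid_morphism phi)
  (phi_scale : scalable phi).
HB.instance Definition _ := GRing.isZmodMorphism.Build _ _ phi phi_add.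
Let phiB u v : phi (u - v) = phi u - phi v. Proof. exact: raddfB. Qed.
Let phiD u v : phi (u + v) = phi u + phi v. Proof. exact: raddfD. Qed.
Let phiZ c u : phi (c *: u) = c *: phi u. Proof. exact: phi_scale. Qed.
Let phi1 : phi 1 = 1. Proof. by case: phi_mul. Qed.
Let phiM u v : phi (u * v) = phi u * phi v. Proof. by case: phi_mul. Qed.
Variables (x y z t : F) (X Y Z T : 'M[K]_N).
Hypotheses (hx : phi x = X) (hy : phi y = Y) (hz : phi z = Z) (ht : phi t = T).

Lemma eval_rel1 : X * Y = 1 -> phi (x * y - 1) = 0.
Proof. by move=> h; rewrite phiB phiM phi1 hx hy h subrr. Qed.

Lemma eval_rel2 : X * Y = Y * X -> phi (x * y - y * x) = 0.
Proof. by move=> h; rewrite phiB !phiM hx hy h subrr. Qed.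

Lemma eval_rel3 c : X * Y * Z = c *: Y -> phi (x * y * z - c *: y) = 0.
Proof.
by move=> h; rewrite phiB !phiM phi_scale hx hy hz h subrr.
Qed.

Lemma eval_rel4 c : X * Y - Y * X = c *: (Z - T) ->
  phi (x * y - y * x - c *: (z - t)) = 0.
Proof.
move=> h; rewrite !phiB phiZ !phiM phiB.
by rewrite hx hy hz ht h subrr.
Qed.

Lemma eval_rel5 c : X * X = 0 -> X * Y * X = 0 ->
  phi (x ^+ 2 * y - c *: (x * y * x) + y * x ^+ 2) = 0.
Proof.
move=> h1 h2; rewrite expr2 phiD phiB phiZ !phiM hx hy h1 h2.
by rewrite mul0r mulr0 scaler0 subrr addr0.
Qed.
End EvalRelations.

Section NaturalRelations.
Variables (K : fieldType) (n : nat) (q : K).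
Local Notation N := n.*2.
Local Notation lo := (lo n).
Local Notation hi := (hi n).
Local Notation bar := (bar n).
Local Notation E := (munit K n).
Local Notation nat_e := (nat_e K n).
Local Notation nat_f := (nat_f K n).
Local Notation nat_k := (nat_k n q).
Local Notation nat_kinv := (nat_kinv n q).
Hypotheses (hn : (2 < n)%N) (hq0 : q != 0) (hq2 : q ^+ 2 != 1).
Let root_formE := @root_formE K n q hn hq0 hq2.
Let root_form_wt := @root_form_wt K n q hn hq0 hq2.

Lemma root_form_diag i : (0 < i <= n)%N -> root_form n i i = 2.
Proof.
move=> hi'; rewrite root_formE // /alpha; repeat case: ifP => ?; try lia; decide_eqs; try by [].
Qed.

Lemma root_form_eq0 i j : (0 < i <= n)%N -> (0 < j <= n)%N ->
  root_form n i j = 0 ->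
  [\/ [/\ (i < n)%N, (j < n)%N & (i.+1 < j)%N \/ (j.+1 < i)%N],
      [/\ i = n, (j < n)%N & j.+2 != n] |
      [/\ j = n, (i < n)%N & i.+2 != n] ].
Proof.
move=> hi' hj; have [<-|nij] := eqVneq i j; first by rewrite root_form_diag.
rewrite root_formE // /alpha.
repeat case: ifP => ?; try lia; decide_eqs => // ?; subst;
 solve [constructor 1; split; lia | constructor 2; split; lia
       | constructor 3; split; lia].
Qed.

Let G a b := E a b - E (bar b) (bar a).

Lemma GM a b c d : (0 < a <= N)%N -> (0 < b <= N)%N -> (0 < c <= N)%N ->
  (0 < d <= N)%N ->
  G a b * G c d =
    (b == c)%:R *: E a d - (b == bar d)%:R *: E a (bar c)
    - ((bar a == c)%:R *: E (bar b) d - (a == d)%:R *: E (bar b) (bar c)).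
Proof.
move=> ha hb hc hd; have <- : (bar a == bar d) = (a == d) by rewrite /bar; lia.
by rewrite mulrBl !mulrBr !munitM // /bar; lia.
Qed.

Lemma nat_fE i : nat_f i = G (hi i) (lo i).
Proof. by rewrite /nat_f /G /lo /hi; case: ifP. Qed.

Ltac step := rewrite ?scale1r ?scale0r ?subr0 ?sub0r ?addr0 ?add0r ?opprK
  ?mulr0 ?mul0r ?oppr0 ?subrr //.

Lemma nat_e_sq i : (0 < i <= n)%N -> nat_e i * nat_e i = 0.
Proof.
move=> hi'; rewrite nat_eE -/(G _ _) GM /lo /hi /bar; case: ifP => ?; try lia;
  decide_eqs; step.
Qed.

Lemma nat_ee_comm i j : (0 < i <= n)%N -> (0 < j <= n)%N ->
  root_form n i j = 0 -> nat_e i * nat_e j = nat_e j * nat_e i.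
Proof.
move=> hi' hj h0; rewrite !nat_eE -!/(G _ _) !GM /lo /hi /bar;
 try (case: ifP => ?; lia).

case: (root_form_eq0 hi' hj h0) => -[h1 h2 h3]; repeat case: ifP => ?; try lia;
  decide_eqs; step.
all: rewrite ?[in RHS]addrC; congr (_ + _) || idtac; congr (- E _ _) || congr (E _ _) || idtac; lia.
Qed.

Lemma nat_eee i j : (0 < i <= n)%N -> (0 < j <= n)%N -> i <> j ->
  nat_e i * nat_e j * nat_e i = 0.
Proof.
move=> hi' hj nij; rewrite !nat_eE -!/(G _ _) GM /lo /hi /bar;
  try (case: ifP => ?; lia).
repeat case: ifP => ?; try lia; decide_eqs; step.
all: rewrite /G ?mulNr ?mulrBl ?mulrBr ?munitM /bar; try lia.
all: decide_eqs; step.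
Qed.

Lemma nat_ef_neq i j : (0 < i <= n)%N -> (0 < j <= n)%N -> i <> j ->
  nat_e i * nat_f j = nat_f j * nat_e i.
Proof.
move=> hi' hj nij; rewrite !nat_fE !nat_eE -!/(G _ _) !GM /lo /hi /bar;
 try (case: ifP => ?; lia).
repeat case: ifP => ?; try lia;
  decide_eqs; step.
all: congr (E _ _) || idtac; lia.
Qed.

Lemma nat_ef_eq i : (0 < i <= n)%N ->
  nat_e i * nat_f i - nat_f i * nat_e i =
  (1 / (q - q^-1)) *: (nat_k i - nat_kinv i).
Proof.
move=> hi'.
have -> : nat_e i * nat_f i - nat_f i * nat_e i =
    E (lo i) (lo i) + E (bar (hi i)) (bar (hi i))
    - (E (hi i) (hi i) + E (bar (lo i)) (bar (lo i))).
  rewrite nat_fE nat_eE -!/(G _ _) !GM; try (rewrite /lo /hi; case: ifP => ?; lia).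
  by rewrite /lo /hi /bar; case: ifP => ?; decide_eqs; step.
have qq : q - q^-1 != 0.
  by rewrite subr_eq0 -(inj_eq (mulfI hq0)) divff // -expr2.
have zq : q ^ (-1) = q^-1 by [].
rewrite /nat_k /nat_kinv !nat_diagE; apply/matrixP=> x y.
have [<-|nxy] := eqVneq x y; last first.
  have E0 a : E a a x y = 0.
    rewrite mxE; case: eqP => //= xa; case: eqP => //= ya.
    case/eqP: nxy; apply: ord_inj; apply: succn_inj; by rewrite xa ya.
  have mxE4 (M1 M2 M3 M4 : 'M[K]_N) :
      (M1 + M2 - (M3 + M4)) x y = M1 x y + M2 x y - (M3 x y + M4 x y).
    by rewrite !mxE.
  by rewrite mxE4 !E0 !mxE (negbTE nxy) !mulr0n !subrr mulr0.
have := ltn_ord x; move: (nat_of_ord x) => p pN.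
rewrite !mxE !eqxx !mulr1n !andbb /nat_wt /lo /hi /bar; case: ifP => ?.
all: decide_eqs; step; rewrite ?expr1z ?expr0z ?zq; step.
all: by rewrite -?(opprB q q^-1) ?mulrN div1r mulVf.
Qed.

Lemma nat_ke i j : (0 < i <= n)%N -> (0 < j <= n)%N ->
  nat_k i * nat_e j * nat_kinv i = q ^ root_form n i j *: nat_e j.
Proof.
move=> hi' hj; have [w1 w2] := root_form_wt hi' hj.
rewrite nat_eE mulrBr mulrBl !nat_diag_conj // scalerBr {1}w1 w2.
by [].
Qed.

Lemma nat_kf i j : (0 < i <= n)%N -> (0 < j <= n)%N ->
  nat_k i * nat_f j * nat_kinv i = q ^ (- root_form n i j) *: nat_f j.
Proof.
move=> hi' hj; have [w1 w2] := root_form_wt hi' hj.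
rewrite nat_fE mulrBr mulrBl !nat_diag_conj // scalerBr {1}w1 w2 !opprB.
by [].
Qed.

Lemma nat_gen_rel (r : {malg K[{fmonom (Uq_gen n)}]}) :
  Uq_rel q r -> free_eval (nat_gen q) r = 0.
Proof.
have ft i j : nat_f i * nat_f j = (nat_e j * nat_e i)^T.
  by rewrite !nat_f_tr -[_ * _]/(_ *m _) -trmx_mul.
have ev := @free_eval_gen K (Uq_gen n) N (nat_gen q).
case=> [i|i|i j|i j|i j|i j|i j h|i j h|i j h|i j h].
- refine (eval_rel1 (@free_eval_zmod _ _ _ (nat_gen q)) (@free_eval_monoid _ _ _ _)
    (ev (Gk i)) (ev (Gkinv i)) _) => /=.
  by rewrite nat_diagM // nat_diag0 // => k; rewrite subrr.
- refine (eval_rel1 (@free_eval_zmod _ _ _ (nat_gen q)) (@free_eval_monoid _ _ _ _)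
    (ev (Gkinv i)) (ev (Gk i)) _) => /=.
  by rewrite nat_diagM // nat_diag0 // => k; rewrite addNr.
- refine (eval_rel2 (@free_eval_zmod _ _ _ (nat_gen q)) (@free_eval_monoid _ _ _ _)
    (ev (Gk i)) (ev (Gk j)) _) => /=; rewrite !nat_diagM //.
  by apply: eq_nat_diag => k; rewrite addrC.
- refine (eval_rel3 (@free_eval_zmod _ _ _ (nat_gen q)) (@free_eval_monoid _ _ _ _) (@free_evalZ _ _ _ _)
    (ev (Gk i)) (ev (Ge j)) (ev (Gkinv i)) _) => /=.
  by rewrite nat_ke ?(valP i) ?(valP j).
- refine (eval_rel3 (@free_eval_zmod _ _ _ (nat_gen q)) (@free_eval_monoid _ _ _ _) (@free_evalZ _ _ _ _)
    (ev (Gk i)) (ev (Gf j)) (ev (Gkinv i)) _) => /=.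
  by rewrite nat_kf ?(valP i) ?(valP j).
- refine (eval_rel4 (@free_eval_zmod _ _ _ (nat_gen q)) (@free_eval_monoid _ _ _ _) (@free_evalZ _ _ _ _)
    (ev (Ge i)) (ev (Gf j)) (ev (Gk i)) (ev (Gkinv i)) _) => /=.
  case: eqVneq => [<-|nij]; first by rewrite nat_ef_eq ?(valP i).
  rewrite nat_ef_neq ?(valP i) ?(valP j) //; last first.
    by move=> /val_inj ij; rewrite ij eqxx in nij.
  by rewrite subrr mul0r scale0r.
- refine (eval_rel2 (@free_eval_zmod _ _ _ (nat_gen q)) (@free_eval_monoid _ _ _ _)
    (ev (Ge i)) (ev (Ge j)) _) => /=.
  by rewrite nat_ee_comm ?(valP i) ?(valP j).
- have nij : val i <> val j.
    by move=> ij; move: h; rewrite ij root_form_diag ?(valP j).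
  refine (eval_rel5 (@free_eval_zmod _ _ _ (nat_gen q)) (@free_eval_monoid _ _ _ _) (@free_evalZ _ _ _ _)
    (ev (Ge i)) (ev (Ge j)) (q + q^-1) _ _) => /=.
    by rewrite nat_e_sq ?(valP i).
  by rewrite nat_eee ?(valP i) ?(valP j).
- refine (eval_rel2 (@free_eval_zmod _ _ _ (nat_gen q)) (@free_eval_monoid _ _ _ _)
    (ev (Gf i)) (ev (Gf j)) _) => /=.
  by rewrite !ft (@nat_ee_comm (val i) (val j)) ?(valP i) ?(valP j).
- have nij : val i <> val j.
    by move=> ij; move: h; rewrite ij root_form_diag ?(valP j).
  refine (eval_rel5 (@free_eval_zmod _ _ _ (nat_gen q)) (@free_eval_monoid _ _ _ _) (@free_evalZ _ _ _ _)
    (ev (Gf i)) (ev (Gf j)) (q + q^-1) _ _) => /=.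
    by rewrite ft nat_e_sq ?(valP i) ?trmx0.
  rewrite !nat_f_tr -[_ * _ * _]/(_ *m _ *m _) -!trmx_mul mulmxA.
  by rewrite -[_ *m _ *m _]/(_ * _ * _) nat_eee ?trmx0 ?(valP i) ?(valP j).
Qed.

End NaturalRelations.

Definition not_root_of_unity (K : fieldType) (q : K) :=
  forall k, (0 < k)%N -> q ^+ k != 1.

Section NaturalRepresentationOfUq.
Variables (K : fieldType) (n : nat) (q : K).
Hypotheses (hn : (3 <= n)%N) (hq0 : q != 0) (hq : not_root_of_unity q).

Definition natural_rep : Uq n q -> 'M[K]_(n.*2) :=
  quot_rep (nat_gen_rel hn hq0 (hq (isT : (0 < 2)%N))).

HB.instance Definition _ := GRing.RMorphism.copy natural_rep
  (quot_rep (nat_gen_rel hn hq0 (hq (isT : (0 < 2)%N)))).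
HB.instance Definition _ := GRing.Linear.copy natural_rep
  (quot_rep (nat_gen_rel hn hq0 (hq (isT : (0 < 2)%N)))).

Lemma natural_rep_at (G : node n -> Uq_gen n) (M : nat -> 'M[K]_(n.*2)) i :
  (forall j, nat_gen q (G j) = M (val j)) ->
  (0 < i <= n)%N -> natural_rep (Uq_at q G i) = M i.
Proof.
move=> GM hi; rewrite /Uq_at insubT [LHS]quot_repE.
by rewrite free_eval_gen GM.
Qed.

Lemma natural_rep_e i : (0 < i <= n)%N ->
  natural_rep (Uq_e n q i) = nat_e K n i.
Proof. exact: natural_rep_at. Qed.
Lemma natural_rep_f i : (0 < i <= n)%N ->
  natural_rep (Uq_f n q i) = nat_f K n i.
Proof. exact: natural_rep_at. Qed.
Lemma natural_rep_k i : (0 < i <= n)%N ->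
  natural_rep (Uq_k n q i) = nat_k n q i.
Proof. exact: natural_rep_at. Qed.
Lemma natural_rep_kinv i : (0 < i <= n)%N ->
  natural_rep (Uq_kinv n q i) = nat_kinv n q i.
Proof. exact: natural_rep_at. Qed.

End NaturalRepresentationOfUq.

Inductive subalg_gen (K : comNzRingType) (A : lalgType K) (S : A -> Prop)
    (G : quot_alg S -> Prop) : quot_alg S -> Prop :=
| subalg_gen_in x : G x -> subalg_gen G x
| subalg_gen1 : subalg_gen G 1
| subalg_genD x y : subalg_gen G x -> subalg_gen G y -> subalg_gen G (x + y)
| subalg_genM x y : subalg_gen G x -> subalg_gen G y -> subalg_gen G (x * y)
| subalg_genZ c x : subalg_gen G x -> subalg_gen G (c *: x).

Section CoidealSubalgebra.
Variables (K : fieldType) (n m : nat) (q : K) (y : nat -> K).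
Local Notation N := n.*2.
Local Notation U := (Uq n q).

Definition mat_A : 'M[K]_N :=
  \sum_(1 <= i < m.+1)
     (q ^- m * (1 - q ^ (- N%:Z + m.*2%:Z))) *: munit K n i i
  + \sum_(m.+1 <= i < bar n m) q ^- m *: munit K n i i
  + \sum_(1 <= i < N.+1 | (i <= m)%N || (bar n i <= m)%N)
      y i *: munit K n i (bar n i).

Definition Pi_l (i : nat) : bool := (m <= n - 2)%N && (m < i <= n)%N.

(* An element beta of the root lattice is given by its coefficients
   on the simple roots. *)
Definition sroot (i : nat) : nat -> int := fun j => (j == i)%:Z.

Definition Uq_kpow (i : nat) (z : int) : U := match z with
  | Posz k => Uq_k n q i ^+ k | Negz k => Uq_kinv n q i ^+ k.+1 end.

Definition Uq_qh (beta : nat -> int) : U :=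
  \prod_(1 <= i < n.+1) Uq_kpow i (beta i).

Definition qcomm (a : K) (x z : U) : U := x * z - a *: (z * x).

Definition Uq_F (i : nat) : U := Uq_k n q i * Uq_f n q i.

(* The next three definitions are meant for 1 <= i <= n with alpha_i not in
   Pi_l.  When i >= m this leaves i = n if m = n, i = n - 1 or i = n if
   m = n - 1, and i = m if m <= n - 2. *)
Definition tilde_root (i : nat) : nat -> int :=
  if (i < m)%N then sroot i
  else if m == n then sroot n
  else if m == n.-1 then (if i == n then sroot n.-1 else sroot n)
  else fun j => sroot m j + 2 * (m < j <= n - 2)%N%:Z + sroot n.-1 j + sroot n j.

(* For m = n - 2 the second half of the list of indices is empty. *)
Definition tilde_F (i : nat) : U :=
  if (i < m)%N then Uq_F i
  else if m == n then Uq_F n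
  else if m == n.-1 then (if i == n then Uq_F n.-1 else Uq_F n)
  else foldl (fun x j => qcomm q x (Uq_F j)) (Uq_F m)
         (index_iota m.+1 n.+1 ++ rev (index_iota m.+1 n.-1)).

Definition coef_c (i : nat) : K :=
  if (i < m)%N then - (q * y i.+1 / y i)
  else if m == n then - (y n.-1 * y n * q ^+ (n.*2 - 1))^-1
  else if m == n.-1 then - (y n.-1 * q ^+ n)^-1
  else (-1) ^+ (n - m) / (y m * q ^+ m.+1).

Definition tilde_diff (i : nat) : nat -> int :=
  fun j => tilde_root i j - sroot i j.

Definition Uk_X (i : nat) : U :=
  Uq_qh (tilde_diff i) * Uq_e n q i + coef_c i *: tilde_F i.

Inductive Uk_gen : U -> Prop :=
| Uk_gen_e i : (1 <= i <= n)%N -> Pi_l i -> Uk_gen (Uq_e n q i)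
| Uk_gen_f i : (1 <= i <= n)%N -> Pi_l i -> Uk_gen (Uq_f n q i)
| Uk_gen_k i : (1 <= i <= n)%N -> Pi_l i -> Uk_gen (Uq_k n q i)
| Uk_gen_kinv i : (1 <= i <= n)%N -> Pi_l i -> Uk_gen (Uq_kinv n q i)
| Uk_gen_X i : (1 <= i <= n)%N -> ~~ Pi_l i -> Uk_gen (Uk_X i)
| Uk_gen_h i : (1 <= i <= n)%N -> ~~ Pi_l i -> Uk_gen (Uq_qh (tilde_diff i))
| Uk_gen_hinv i : (1 <= i <= n)%N -> ~~ Pi_l i ->
    Uk_gen (Uq_qh (fun j => - tilde_diff i j)).

Definition Uk : U -> Prop := subalg_gen Uk_gen.

End CoidealSubalgebra.

(* Main.v *)
Require Import Defs.
From mathcomp Require Import all_boot all_order all_algebra.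
From mathcomp Require Import reals zify ring.
From mathcomp.real_closed Require Import complex.

Set Implicit Arguments.
Unset Strict Implicit.
Unset Printing Implicit Defensive.

Import Order.TTheory GRing.Theory Num.Theory.
Local Open Scope ring_scope.

(** Let d_i and s_i be the entries of A at (i, i) and (i, i'), so that
    E_{ij} A = d_j E_{ij} + s_j E_{ij'} and A E_{ij} = d_i E_{ij} + s_{i'} E_{i'j}.
    Apart from the Cartan elements, each generator of U_q(k) acts by a combination of
    at most four matrix units, so that commutation with A reduces to a few identities
    between coefficients:
    - for alpha_i in Pi_l only indices strictly between m and m' occur, where A is
      the scalar q^{-m};
    - a Cartan element commutes with A because its weight vanishes on
      epsilon_1, ..., epsilon_m;
    - X_{alpha_i} with tilde alpha_i = alpha_i acts by
      E_{ab} - E_{b'a'} + g (E_{ba} - E_{a'b'});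
    - the other X_{alpha_i} have m < n and, with b = m+1 or b = n+1, act by
      E_{mb} - q^{-2} E_{b'm'} + g (E_{b'm} - q^{-2(n-m-1)} E_{m'b}).
    For the last formula, every step of the iterated q-commutator F_{tilde alpha_m}
    turns a E_{rm} - b E_{m'r'} into an element of the same shape with another r. *)

(** Restates [scalemxAl] for the ring product [*], in which all the computations below are
    written. *)
Lemma mulmx_scalel (K : comNzRingType) (N : nat) (c : K) (M P : 'M[K]_N) :
  (c *: M) * P = c *: (M * P).
Proof. exact/esym/scalemxAl. Qed.

Lemma mulmx_scaler (K : comNzRingType) (N : nat) (c : K) (M P : 'M[K]_N) :
  M * (c *: P) = c *: (M * P).
Proof. exact/esym/scalemxAr. Qed.

(** * The involution [i -> i'], and diagonal matrices times matrix units *)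

Section MatrixUnits.
Variables (K : fieldType) (n : nat) (q : K).
Local Notation N := n.*2.
Local Notation E := (munit K n).
Local Notation bar := (bar n).

Lemma barK i : (0 < i <= N)%N -> bar (bar i) = i.
Proof. rewrite /Defs.bar; lia. Qed.

Lemma bar_gt0 i : (0 < i <= N)%N -> (0 < bar i <= N)%N.
Proof. rewrite /Defs.bar; lia. Qed.

Lemma bar_eqC i k : (0 < k <= N)%N -> (0 < i <= N)%N -> (bar k == i) = (bar i == k).
Proof. rewrite /Defs.bar; lia. Qed.

Lemma nat_diag_munit d i j : nat_diag n q d * E i j = q ^ d i *: E i j.
Proof.
rewrite nat_diagE -[_ * _]/(_ *m _) mul_diag_mx; apply/matrixP => x z.
by rewrite !mxE; case: eqP => [->|]; rewrite ?mulr0.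
Qed.

Lemma munit_nat_diag d i j : E i j * nat_diag n q d = q ^ d j *: E i j.
Proof.
rewrite nat_diagE -[_ * _]/(_ *m _) mul_mx_diag; apply/matrixP => x z.
by rewrite !mxE andbC; case: eqP => [->|]; rewrite ?mulr0 ?mul0r // mulrC.
Qed.

End MatrixUnits.

(** * Products of [A] with matrix units, and criteria for commuting with [A] *)

Section FixedMatrix.
Variables (K : fieldType) (n m : nat) (q : K) (y : nat -> K).
Hypothesis hm : (m <= n)%N.
Local Notation N := n.*2.
Local Notation E := (munit K n).
Local Notation bar := (bar n).
Local Notation A := (mat_A n m q y).

Definition diag_A (i : nat) : K :=
  if (i <= m)%N then q ^- m * (1 - q ^ (- N%:Z + m.*2%:Z))
  else if (i < bar m)%N then q ^- m else 0.

Definition antidiag_A (i : nat) : K :=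
  if (i <= m)%N || (bar i <= m)%N then y i else 0.

Local Notation d := diag_A.
Local Notation s := antidiag_A.

(** Each of the three sums is widened to the range [1..N], its old range becoming a condition. Since
    [i <= m] and [m < i < m'] exclude each other, the conditions merge into [d] and [s]. *)
Lemma mat_AE :
  A = \sum_(1 <= i < N.+1) (d i *: E i i + s i *: E i (bar i)).
Proof.
have sumD (F G : nat -> 'M[K]_N) : \sum_(1 <= i < N.+1) F i
    + \sum_(1 <= i < N.+1) G i = \sum_(1 <= i < N.+1) (F i + G i).
  by rewrite big_split.
rewrite /mat_A [X in X + _ + _](@big_nat_widen _ _ _ _ _ N.+1) ?ltnS; last lia.
rewrite [X in _ + X + _](@big_nat_widenl _ _ _ _ 1) //.
rewrite [X in _ + X + _](@big_nat_widen _ _ _ _ _ N.+1); last first.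
  by rewrite /Defs.bar; lia.
rewrite [X in X + _ + _]big_mkcond [X in _ + X + _]big_mkcond.
rewrite [X in _ + _ + X]big_mkcond /=.
rewrite !sumD; apply: eq_big_nat => i hi.
rewrite /d /s ltnS ltnNge; case: (i <= m)%N => /=; repeat case: ifP => _;
  by rewrite ?scale0r ?addr0 ?add0r.
Qed.

Lemma munit_mulA i j : (0 < j <= N)%N -> E i j * A = d j *: E i j + s j *: E i (bar j).
Proof.
move=> hj; rewrite mat_AE mulr_sumr.
under eq_big_nat => k hk.
  rewrite mulrDr !mulmx_scaler !munitM // !(mulr1, scalerA).
  rewrite 2!(mulrC _ (j == k)%:R) -!scalerA -scalerDr.
  over.
rewrite (eq_bigr (fun k => if k == j then
  d k *: E i k + s k *: E i (bar k) else 0)); last first.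
  by move=> k _; rewrite eq_sym; case: eqP; rewrite ?scale1r ?scale0r.
rewrite -big_mkcond big_nat1_eq.
by rewrite ifT.
Qed.

Lemma mulA_munit i j : (0 < i <= N)%N ->
  A * E i j = d i *: E i j + s (bar i) *: E (bar i) j.
Proof.
move=> hi; rewrite mat_AE mulr_suml.
under eq_big_nat => k hk.
  rewrite mulrDl !mulmx_scalel munitM // munitM ?bar_gt0 // (bar_eqC hk) //.
  rewrite !scalerA.
  over.
rewrite big_split /=; congr (_ + _).
  rewrite (eq_bigr (fun k => if k == i then d k *: E k j else 0)); last first.
    by move=> k _; case: eqP => [->|_]; rewrite ?mulr1 // mulr0 scale0r.
  by rewrite -big_mkcond big_nat1_eq ifT.
rewrite (eq_bigr (fun k => if k == bar i then s k *: E k j else 0)); last first.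
  by move=> k _; rewrite eq_sym; case: eqP; rewrite ?mulr1 // mulr0 scale0r.
by rewrite -big_mkcond big_nat1_eq ifT ?bar_gt0 // ltnS bar_gt0.
Qed.

(** The conditions on [d] match the coefficients of the four units of [X]. The condition on [s b]
    matches [E a b'] and [E b a'], and the one on [s a'] matches [E a' b] and [E b' a]. *)
Lemma commute_linked_pair a b g :
  (0 < a <= N)%N -> (0 < b <= N)%N ->
  d a = d b -> d (bar a) = d (bar b) ->
  s b = - g * s a -> s (bar a) = - g * s (bar b) ->
  let X := E a b - E (bar b) (bar a) + g *: (E b a - E (bar a) (bar b)) in
  X * A = A * X.
Proof.
move=> ha hb dab dab' sb sa' /=; have [ha' hb'] := (bar_gt0 ha, bar_gt0 hb).
(* A is generalized because mulrDl and mulrDr would unfold it into a sum. *)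
move: (@munit_mulA) (@mulA_munit); move: A => B BE EB.
rewrite !(mulrDl, mulrDr, mulrN, mulNr, mulmx_scalel, mulmx_scaler).
rewrite !BE // !EB // !barK // dab dab' sb sa'.
by apply/matrixP => u v; do !rewrite [in RHS]mxE; do !rewrite mxE; ring.
Qed.

(** Here [a] is the boundary index [m] and [r] the scalar by which [A] acts on the middle block
    containing [b]. As [s b = 0], both products involve only the four units of [X]. The last three
    hypotheses match the coefficients of [E a b], [E a' b] and [E b' a'], and they imply the
    identity for [E b' a]. *)
Lemma commute_twisted_pair a b g u w r :
  (0 < a <= N)%N -> (0 < b <= N)%N ->
  d b = r -> d (bar b) = r -> d (bar a) = 0 -> s b = 0 ->
  d a = r + g * w * s a -> s (bar a) = - g * w * r -> u * r = - g * s a ->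
  let X := E a b - u *: E (bar b) (bar a)
           + g *: (E (bar b) a - w *: E (bar a) b) in
  X * A = A * X.
Proof.
move=> ha hb db db' da' sb da sa' ur /=.
have [ha' hb'] := (bar_gt0 ha, bar_gt0 hb).
move: (@munit_mulA) (@mulA_munit); move: A => B BE EB.
rewrite !(mulrDl, mulrDr, mulrN, mulNr, mulmx_scalel, mulmx_scaler).
rewrite !BE // !EB // !barK // db db' da' sb da sa'.
apply/matrixP => i j; do !rewrite [in RHS]mxE; do !rewrite mxE.
ring: ur.
Qed.

Lemma commute_munit_levi i j : (m < i < bar m)%N -> (m < j < bar m)%N ->
  E i j * A = A * E i j.
Proof.
move=> hi hj; have [hi' hj'] : (0 < i <= N)%N /\ (0 < j <= N)%N.
  by move: hi hj; rewrite /Defs.bar; lia.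
rewrite munit_mulA // mulA_munit // /diag_A /antidiag_A.
have -> : (i <= m)%N = false by lia.
have -> : (j <= m)%N = false by lia.
have -> : (bar i <= m)%N = false by move: hi; rewrite /Defs.bar; lia.
have -> : (bar j <= m)%N = false by move: hj; rewrite /Defs.bar; lia.
rewrite barK // /=; have -> : (i <= m)%N = false by lia.
have -> : (i < bar m)%N by lia.
have -> : (j < bar m)%N by lia.
by rewrite !scale0r.
Qed.

(** Only the antidiagonal part of [A] is an obstruction, and its entries vanish unless [j <= m] or
    [j' <= m]. *)
Lemma commute_nat_diag f :
  (forall j, (0 < j <= m)%N -> f j = f (bar j)) ->
  nat_diag n q f * A = A * nat_diag n q f.
Proof.
move=> fE; rewrite mat_AE mulr_sumr mulr_suml; apply: eq_big_nat => j hj.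
rewrite mulrDl mulrDr !mulmx_scalel !mulmx_scaler.
rewrite !nat_diag_munit !munit_nat_diag; congr (_ + _).
rewrite /antidiag_A; case: ifP => [h|_]; last by rewrite !scale0r.
suff -> : f j = f (bar j) by [].
case/orP: h => h; first by apply: fE; lia.
have hj' : (0 < j <= N)%N by lia.
by rewrite (fE (bar j)) ?barK // h andbT; case/andP: (bar_gt0 hj').
Qed.

End FixedMatrix.

(** * Weights of the Cartan elements in the natural representation *)

Section Weights.
Variable n : nat.
Local Notation bar := (bar n).

(** The exponent of [q] in the action of [q^{h_beta}] on the [j]-th basis vector, that is, the
    pairing of [beta] with the weight of that vector. *)
Definition weight (beta : nat -> int) (j : nat) : int :=
  \sum_(1 <= i < n.+1) beta i * nat_wt n i j.

Lemma weight_bar beta j : (0 < j <= n.*2)%N -> weight beta (bar j) = - weight beta j.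
Proof.
move=> hj; rewrite /weight -sumrN; apply: eq_big_nat => i hi; rewrite -mulrN.
congr (_ * _); rewrite /nat_wt /Defs.bar; case: ifP => ?; decide_eqs; lia.
Qed.

(** This is the coordinate of [beta] on [epsilon_j]: [alpha_j] and [alpha_{j-1}] contribute with
    opposite signs, and [alpha_n] also contributes at [n-1]. The factor [(1 < j)] discards the
    meaningless value [beta 0]. *)
Lemma weightE beta j : (2 < n)%N -> (0 < j <= n)%N ->
  weight beta j = beta j - (1 < j)%N%:Z * beta j.-1 + (j == n.-1)%:Z * beta n.
Proof.
move=> hn hj.
have delta k (c : int) : c * \sum_(1 <= i < n.+1) beta i * (i == k)%:Z
    = (0 < k <= n)%N%:Z * c * beta k.
  rewrite (eq_bigr (fun i => if i == k then beta k else 0)); last first.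
    by move=> i _; case: eqP => [->|_]; rewrite ?mulr1 // mulr0.
  rewrite -big_mkcond big_nat1_eq ltnS; case: ifP => _; first by rewrite mul1r.
  by rewrite mul0r mul0r mulr0.
transitivity (1 * (\sum_(1 <= i < n.+1) beta i * (i == j)%:Z)
   - 1 * (\sum_(1 <= i < n.+1) beta i * (i == j.-1)%:Z)
   + (j == n.-1)%:Z * \sum_(1 <= i < n.+1) beta i * (i == n)%:Z).
  rewrite !mul1r mulr_sumr -sumrB -big_split; apply: eq_big_nat => i hi /=.
  rewrite mulrCA -mulrBr -mulrDr; congr (_ * _).
  rewrite /nat_wt /Defs.bar; case: ifP => ?; decide_eqs; lia.
rewrite !delta hj; have -> : (0 < n <= n)%N by lia.
have -> : (0 < j.-1 <= n)%N = (1 < j)%N by lia.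
by rewrite !mul1r mulr1.
Qed.

(** The difference [tilde alpha_i - alpha_i] is [0] in the reflexive cases, [2 epsilon_{m+1}] for
    [i = m < n], and [-2 epsilon_n] for [i = n], [m = n-1]. None of these involves
    [epsilon_1, ..., epsilon_m]. *)
Lemma weight_tilde_diff_fixed m i j : (2 < n)%N -> (m <= n)%N -> (0 < i <= n)%N ->
  ~~ Pi_l n m i -> (0 < j <= m)%N -> weight (tilde_diff n m i) j = 0.
Proof.
rewrite /Pi_l => hn hm hi hPi hj; rewrite weightE //; last lia.
rewrite /tilde_diff /tilde_root; repeat case: ifP => ?;
  rewrite /sroot; decide_eqs; subst; lia.
Qed.

(** Source of the factor [q^{-2}] in the action of the non-reflexive [X_{alpha_i}]. *)
Lemma weight_tilde_diff_hi m i : (2 < n)%N -> (0 < m < n)%N -> (m <= i <= n)%N ->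
  ~~ Pi_l n m i -> weight (tilde_diff n m i) (bar (hi n i)) = -2.
Proof.
rewrite /Pi_l => hn /andP[hm0 hm] hi0 hPi.
have [ni|ni] : i = n /\ m = n.-1 \/ (i < n)%N /\ i = m by lia.
  case: ni => -> ->; rewrite /hi ltnn; have -> : bar n.+1 = n by rewrite /Defs.bar; lia.
  rewrite weightE //; last lia.
  rewrite /tilde_diff /tilde_root; repeat case: ifP => ?;
  rewrite /sroot; decide_eqs; subst; lia.
case: ni => ni ->; rewrite /hi hm weight_bar; last lia.
rewrite weightE //.
rewrite /tilde_diff /tilde_root; repeat case: ifP => ?;
  rewrite /sroot; decide_eqs; subst; lia.
Qed.

Lemma lo_notin_Pi_l m i : (2 < n)%N -> (m < n)%N -> (m <= i <= n)%N ->
  ~~ Pi_l n m i -> lo n i = m.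
Proof. rewrite /Pi_l /lo; case: ifP; lia. Qed.

Lemma tilde_diff_reflexive m i : (i < m)%N || (m == n) && (i == n) ->
  tilde_diff n m i =1 (fun=> 0).
Proof.
move=> h j; rewrite /tilde_diff /tilde_root; repeat case: ifP => ?;
  rewrite /sroot; decide_eqs; subst; lia.
Qed.

End Weights.

(** * The iterated q-commutator in terms of matrix units *)

Section TildeF.
Variables (K : fieldType) (n : nat) (q : K).
Hypothesis hq0 : q != 0.
Local Notation N := n.*2.
Local Notation E := (munit K n).
Local Notation bar := (bar n).
Local Notation F j := (q^-1 *: nat_f K n j).

Definition qcomm_mx (X Z : 'M[K]_N) : 'M[K]_N := X * Z - q *: (Z * X).

Definition skew_unit (m : nat) (a b : K) (r : nat) : 'M[K]_N :=
  a *: E r m - b *: E (bar m) (bar r).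

(** Of the eight products of units two survive. [E t r * E r m] comes with [-q * q^-1 = -1], while
    [E m' r' * E r' t'] comes with [q^-1]; hence only [b] picks up a power of [q]. *)
Lemma qcomm_skew_unit m a b r t : (0 < m < r)%N -> (r < bar m)%N ->
  (m < t < bar m)%N -> r != bar t ->
  qcomm_mx (skew_unit m a b r) (q^-1 *: (E t r - E (bar r) (bar t)))
  = skew_unit m (- a) (- (b / q)) t.
Proof.
rewrite /qcomm_mx /skew_unit => hm hr ht hrt.
rewrite !(mulrDl, mulrDr, mulrN, mulNr, mulmx_scalel, mulmx_scaler).
rewrite !munitM; try (move: hm hr ht; rewrite /Defs.bar; lia).
have -> : (m == t) = false by lia.
have -> : (m == bar r) = false by move: hr; rewrite /Defs.bar; lia.
have -> : (bar r == t) = false by move: hrt hm hr ht; rewrite /Defs.bar; lia.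
have -> : (bar r == bar r) = true by rewrite eqxx.
have -> : (r == r) = true by rewrite eqxx.
have -> : (r == bar m) = false by lia.
have -> : (bar t == r) = false by lia.
have -> : (bar t == bar m) = false by move: hm ht; rewrite /Defs.bar; lia.
rewrite !mulr0n !mulr1n !scale0r !scale1r.
by apply/matrixP => u v; do !rewrite [in RHS]mxE; do !rewrite mxE; field.
Qed.

Lemma qcomm_skew_unit_up m a b j : (0 < m < j)%N -> (j < n)%N ->
  qcomm_mx (skew_unit m a b j) (F j) = skew_unit m (- a) (- (b / q)) j.+1.
Proof.
by move=> hm hj; rewrite /nat_f hj qcomm_skew_unit //; rewrite /Defs.bar; lia.
Qed.

(** [F j] is minus the matrix that moves [(j+1)'] to [j'], and this sign cancels the two signs of
    [qcomm_skew_unit]. *)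
Lemma qcomm_skew_unit_down m a b j : (0 < m < j)%N -> (j < n)%N ->
  qcomm_mx (skew_unit m a b (bar j.+1)) (F j) = skew_unit m a (b / q) (bar j).
Proof.
move=> hm hj; have -> : F j = - (q^-1 *: (E (bar j) (bar j.+1)
                              - E (bar (bar j.+1)) (bar (bar j)))).
  by rewrite !barK ?/nat_f ?hj -?scalerN ?opprB //; lia.
rewrite /qcomm_mx mulrN mulNr scalerN -opprD -/(qcomm_mx _ _) qcomm_skew_unit //.
- by rewrite /skew_unit !scaleNr opprB addrC opprK.
all: rewrite /Defs.bar; lia.
Qed.

(** The node [n] links [n] directly to [(n-1)'], so the path of row indices turns around without
    visiting [n']. *)
Lemma qcomm_skew_unit_tip m a b : (0 < m < n.-1)%N ->
  qcomm_mx (skew_unit m a b n) (F n) = skew_unit m a (b / q) (bar n.-1).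
Proof.
move=> hm; have nb : bar n.+1 = n by rewrite /Defs.bar; lia.
have -> : F n = - (q^-1 *: (E (bar n.-1) n - E (bar n) (bar (bar n.-1)))).
  rewrite barK /nat_f ?ltnn -?scalerN ?opprB ?nb; last lia.
  by have -> : n.+1 = bar n by rewrite /Defs.bar; lia.
rewrite /qcomm_mx mulrN mulNr scalerN -opprD -/(qcomm_mx _ _) qcomm_skew_unit //.
- by rewrite /skew_unit !scaleNr opprB addrC opprK.
all: rewrite /Defs.bar; lia.
Qed.

Lemma foldl_qcomm_up m a b k : (0 < m)%N -> (m + k < n)%N ->
  foldl (fun X j => qcomm_mx X (F j)) (skew_unit m a b m.+1) (iota m.+1 k)
  = skew_unit m ((-1) ^+ k * a) ((-1) ^+ k * b / q ^+ k) (m.+1 + k).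
Proof.
move=> hm; elim: k => [|k IH] hk; first by rewrite /= !expr0 !mul1r divr1 addn0.
rewrite -[in iota _ _](addn1 k) iotaD foldl_cat IH /=; last lia.
rewrite qcomm_skew_unit_up ?addnS; try lia.
by congr skew_unit; rewrite !exprS ?invfM; ring.
Qed.

Lemma foldl_qcomm_down m a b k : (0 < m)%N -> (m + k < n)%N ->
  foldl (fun X j => qcomm_mx X (F j)) (skew_unit m a b (bar (m.+1 + k)))
    (rev (iota m.+1 k))
  = skew_unit m a (b / q ^+ k) (bar m.+1).
Proof.
move=> hm; elim: k b => [|k IH] b hk; first by rewrite /= expr0 divr1 addn0.
rewrite -[in iota _ _](addn1 k) iotaD rev_cat /= addnS qcomm_skew_unit_down; try lia.
by rewrite IH; [congr skew_unit; rewrite exprS invfM; ring | lia].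
Qed.

(** The row index runs through [m+1, ..., n], then [(n-1)', ..., (m+1)']. The [n-m-1] ascending
    steps each give a sign, and all [2(n-m-1)] steps divide the second coefficient by [q]. *)
Lemma foldl_qcomm m : (0 < m)%N -> (m <= n - 2)%N -> (2 < n)%N ->
  foldl (fun X j => qcomm_mx X (F j)) (F m)
    (index_iota m.+1 n.+1 ++ rev (index_iota m.+1 n.-1))
  = (-1) ^+ (n - m).-1 *:
    skew_unit m q^-1 (q^-1 / q ^+ (n - m).-1.*2) (bar m.+1).
Proof.
move=> hm hmn hn; rewrite /index_iota.
have -> : (n.+1 - m.+1 = (n - m).-1 + 1)%N by lia.
rewrite iotaD !foldl_cat /=.
have -> : F m = skew_unit m q^-1 q^-1 m.+1.
  by rewrite /skew_unit /nat_f ifT ?scalerBr //; lia.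
rewrite foldl_qcomm_up; try lia.
have -> : (m.+1 + (n - m).-1 = n)%N by lia.
rewrite qcomm_skew_unit_tip; last lia.
(* There are [n-m-2] descending steps, hence none when [m = n-2]. *)
have -> : bar n.-1 = bar (m.+1 + (n.-1 - m.+1)) by congr Defs.bar; lia.
rewrite foldl_qcomm_down; try lia.
have -> : (n - m).-1 = (n.-1 - m.+1).+1 by lia.
rewrite /skew_unit scalerBr !scalerA; congr (_ *: _ - _ *: _).
rewrite doubleS -addnn !exprS exprD !invfM; ring.
Qed.

End TildeF.

(** * Images of the generators of [U_q(k)] under the natural representation *)

Section Representation.
Variables (K : fieldType) (n m : nat) (q : K) (y : nat -> K).
Hypotheses (hn : (3 <= n)%N) (hq0 : q != 0) (hq : not_root_of_unity q).
Local Notation N := n.*2.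
Local Notation E := (munit K n).
Local Notation bar := (bar n).
Local Notation rep := (natural_rep hn hq0 hq).
Local Notation F j := (q^-1 *: nat_f K n j).

Lemma nat_diagX f k : nat_diag n q f ^+ k = nat_diag n q (fun j => f j *+ k).
Proof.
elim: k => [|k IH]; first by rewrite expr0 nat_diag0 // => j; rewrite mulr0n.
by rewrite exprS IH nat_diagM //; apply: eq_nat_diag => j; rewrite mulrS.
Qed.

Lemma natural_rep_kpow i z : (0 < i <= n)%N ->
  rep (Uq_kpow n q i z) = nat_diag n q (fun j => z * nat_wt n i j).
Proof.
move=> hi; case: z => k; rewrite /Uq_kpow rmorphXn /= ?natural_rep_k ?natural_rep_kinv //.
  by rewrite /nat_k nat_diagX; apply: eq_nat_diag => j; rewrite -[Posz k]natz mulr_natl.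
rewrite /nat_kinv nat_diagX; apply: eq_nat_diag => j.
by rewrite NegzE -[Posz k.+1]natz mulNr mulr_natl mulNrn.
Qed.

Lemma natural_rep_qh beta : rep (Uq_qh n q beta) = nat_diag n q (weight n beta).
Proof.
rewrite /Uq_qh rmorph_prod /= /weight; set r := index_iota _ _.
have : all (fun i => 0 < i <= n)%N r by apply/allP => i; rewrite mem_index_iota.
elim: r => [|i r IH] /=; first by rewrite big_nil nat_diag0 // => j; rewrite big_nil.
move=> /andP[hi /IH {}IH]; rewrite big_cons IH natural_rep_kpow // nat_diagM //.
by apply: eq_nat_diag => j; rewrite big_cons.
Qed.

(** Both rows occurring in [f_i] have weight [-1] under [q^{h_i}], whence the scalar [q^-1]. *)
Lemma natural_rep_F i : (0 < i <= n)%N -> rep (Uq_F n q i) = F i.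
Proof.
move=> hi'; rewrite /Uq_F rmorphM /= natural_rep_k // natural_rep_f //.
rewrite nat_fE /nat_k mulrBr !nat_diag_munit scalerBr.
have -> : nat_wt n i (hi n i) = -1.
  rewrite /nat_wt /hi /Defs.bar; case: (ltnP i n) => ?; decide_eqs; lia.
have -> : nat_wt n i (bar (lo n i)) = -1.
  rewrite /nat_wt /lo /Defs.bar; case: (ltnP i n) => ?; decide_eqs; lia.
by [].
Qed.

Lemma natural_repZ c (x : Uq n q) : rep (c *: x) = c *: rep x.
Proof. exact: quot_rep_scalable. Qed.

Lemma natural_rep_qcomm a (x z : Uq n q) :
  rep (qcomm a x z) = rep x * rep z - a *: (rep z * rep x).
Proof.
rewrite /qcomm rmorphB; congr (_ - _); first exact: rmorphM.
by rewrite -rmorphM; exact: natural_repZ.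
Qed.

Lemma natural_rep_foldl_qcomm x r : all (fun j => 0 < j <= n)%N r ->
  rep (foldl (fun x j => qcomm q x (Uq_F n q j)) x r)
  = foldl (fun X j => qcomm_mx q X (F j)) (rep x) r.
Proof.
elim: r x => [//|j r IH] x /= /andP[hj hr].
by rewrite IH // natural_rep_qcomm natural_rep_F.
Qed.

(** The same formula covers [m = n-1], where there is no commutator and the exponents vanish: the
    exchange of [F_{n-1}] and [F_n] is what turns the row [hi n i] into its bar. *)
Lemma natural_rep_tilde_F i : (0 < m < n)%N -> (m <= i <= n)%N -> ~~ Pi_l n m i ->
  rep (tilde_F n m q i) = (-1) ^+ (n - m).-1 *:
    skew_unit n m q^-1 (q^-1 / q ^+ (n - m).-1.*2) (bar (hi n i)).
Proof.
rewrite /Pi_l /tilde_F => hm hi' hPi; rewrite ltnNge; case/andP: (hi') => -> _ /=.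
have -> : (m == n) = false by lia.
case: eqP => [mE|mN]; last first.
  have -> : i = m by lia.
  rewrite natural_rep_foldl_qcomm; last first.
    rewrite all_cat all_rev; apply/andP.
    by split; apply/allP => j; rewrite mem_index_iota; lia.
  rewrite natural_rep_F ?foldl_qcomm; try lia.
  by rewrite /hi; case/andP: hm => _ ->.
have -> : (n - m).-1 = 0%N by lia.
rewrite double0 !expr0 divr1 scale1r /skew_unit -scalerBr.
case: eqP => ni; rewrite natural_rep_F; try lia; congr (_ *: _); rewrite /nat_f /hi.
  rewrite ni ltnn ifT; last lia.
  rewrite mE barK; last lia.
  by congr (munit _ _ _ _ - munit _ _ _ _); rewrite /Defs.bar; lia.
rewrite ltnn ifT; last lia.
rewrite mE barK; last lia.
by congr (munit _ _ _ _ - munit _ _ _ _); rewrite /Defs.bar; lia.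
Qed.

Lemma natural_rep_X i : (0 < i <= n)%N ->
  rep (Uk_X n m q y i) = nat_diag n q (weight n (tilde_diff n m i)) * nat_e K n i
    + coef_c n m q y i *: rep (tilde_F n m q i).
Proof.
move=> hi'; rewrite /Uk_X rmorphD; congr (_ + _); last exact: natural_repZ.
by rewrite rmorphM /= natural_rep_qh natural_rep_e.
Qed.

End Representation.

(** * Coefficient identities for each generator, and passage to the subalgebra *)

Section Invariance.
Variables (K : fieldType) (n m : nat) (q : K) (y : nat -> K).
Hypotheses (hn : (3 <= n)%N) (hq0 : q != 0) (hq : not_root_of_unity q).
Hypothesis hm : (m <= n)%N.
Local Notation N := n.*2.
Local Notation bar := (bar n).
Hypothesis hy : forall i, (1 <= i <= N)%N -> (i <= m)%N || (bar i <= m)%N ->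
  y i * y (bar i) = q ^- N.
Local Notation rep := (natural_rep hn hq0 hq).
Local Notation A := (mat_A n m q y).
Local Notation d := (diag_A n m q).
Local Notation s := (antidiag_A n m y).

Lemma diag_A_low i : (i <= m)%N -> d i = q ^- m - q ^- m / q ^+ (n - m).*2.
Proof.
rewrite /diag_A => ->.
have -> : - N%:Z + m.*2%:Z = - ((n - m).*2)%:Z by lia.
by rewrite -exprnN mulrBr mulr1.
Qed.

Lemma diag_A_mid i : (m < i < bar m)%N -> d i = q ^- m.
Proof. by move=> /andP[h1 h2]; rewrite /diag_A h2 leqNgt h1. Qed.

Lemma diag_A_high i : (bar m <= i)%N -> d i = 0.
Proof.
move=> h; rewrite /diag_A [(i < _)%N]ltnNge h ifF //.
by move: h; rewrite /Defs.bar; lia.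
Qed.

Lemma antidiag_A_out i : (i <= m)%N || (bar i <= m)%N -> s i = y i.
Proof. by rewrite /antidiag_A => ->. Qed.

Lemma antidiag_A_mid i : (m < i < bar m)%N -> s i = 0.
Proof. by move=> h; rewrite /antidiag_A ifF //; move: h; rewrite /Defs.bar; lia. Qed.

Lemma y_neq0 i : (0 < i <= m)%N -> y i != 0.
Proof.
move=> hi; have e : y i * y (bar i) = q ^- N by apply: hy; lia.
by apply: contraTneq (invr_neq0 (expf_neq0 N hq0)) => y0; rewrite -e y0 mul0r eqxx.
Qed.

Lemma y_barE i : (0 < i <= m)%N -> y (bar i) = q ^- N / y i.
Proof.
move=> hi; have <- : y i * y (bar i) = q ^- N by apply: hy; lia.
by rewrite mulrAC divff ?mul1r ?y_neq0.
Qed.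

(** The Cartan factor acts as [1], so [commute_linked_pair] applies with [g = c / q]. The value of
    [c] is the one forced by [s b = - g * s a]; the relation [y_i y_{i'} = q^{-N}] then yields the
    other condition on [s]. *)
Lemma commute_X_reflexive i : (0 < i)%N -> (i < m)%N || (m == n) && (i == n) ->
  rep (Uk_X n m q y i) * A = A * rep (Uk_X n m q y i).
Proof.
move=> i0 hi'; have hin : (0 < i <= n)%N by lia.
have -> : rep (Uk_X n m q y i)
    = nat_e K n i + (coef_c n m q y i / q) *: nat_f K n i.
  rewrite natural_rep_X //.
  rewrite nat_diag0 ?mul1r.
    rewrite -scalerA -(natural_rep_F hn hq0 hq hin); congr (_ + _ *: rep _).
    by rewrite /tilde_F; case: ifP => // ?; case: ifP => ?; [congr Uq_F|]; lia.
  move=> j; rewrite /weight big1_seq // => k _.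
  by rewrite tilde_diff_reflexive // mul0r.
rewrite nat_eE nat_fE; case/orP: hi' => [him|/andP[/eqP mn /eqP ni]].
  have in' : (i < n)%N by lia.
  have yi : y i != 0 by apply: y_neq0; lia.
  have yi1 : y i.+1 != 0 by apply: y_neq0; lia.
  rewrite /lo /hi in'; apply: commute_linked_pair; try lia.
  - by rewrite !diag_A_low //; lia.
  - by rewrite !diag_A_high //; rewrite /Defs.bar; lia.
  - rewrite !antidiag_A_out /coef_c ?him; try lia.
    by field; rewrite ?hq0 ?yi.
  rewrite !antidiag_A_out ?barK /coef_c ?him; try lia.
  rewrite !y_barE; try lia.
  by field; rewrite ?hq0 ?expf_neq0 ?yi ?yi1.
(* For [i = n] the linked pair is [(n-1, n')], so both [y_{n-1}] and [y_n] enter. *)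
rewrite /lo /hi ni ltnn.
have yn : y n != 0 by apply: y_neq0; lia.
have yn1 : y n.-1 != 0 by apply: y_neq0; lia.
have b1 : bar n.+1 = n by rewrite /Defs.bar; lia.
have b2 : n.+1 = bar n by rewrite /Defs.bar; lia.
(* For [m = n] the factor [1 - q^{-N+2m}] vanishes and [A] is purely antidiagonal. *)
have d0 j : (j <= m)%N -> d j = 0.
  by move=> hj; rewrite diag_A_low // mn subnn expr0 divr1 subrr.
apply: commute_linked_pair; try lia.
- by rewrite (d0 n.-1) ?diag_A_high // /Defs.bar; lia.
- by rewrite b1 (d0 n) ?diag_A_high // /Defs.bar; lia.
- rewrite b2 !antidiag_A_out ?barK /coef_c ?mn ?eqxx ?ltnn ?y_barE; try lia.
  have -> : (N - 1 = N.-1)%N by lia.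
  rewrite -[in q ^- N](@prednK N) ?exprS; last lia.
  by field; rewrite ?hq0 ?expf_neq0 ?yn ?yn1.
rewrite b1 !antidiag_A_out ?barK /coef_c ?mn ?eqxx ?ltnn ?y_barE; try lia.
have -> : (N - 1 = N.-1)%N by lia.
rewrite -[in q ^- N](@prednK N) ?exprS; last lia.
by field; rewrite ?hq0 ?expf_neq0 ?yn ?yn1.
Qed.

(** The constant for [m = n-1] is the general one with [n - m = 1], so both cases can be treated
    together. *)
Lemma coef_c_boundary i : (m < n)%N -> (m <= i)%N ->
  coef_c n m q y i = (-1) ^+ (n - m) / (y m * q ^+ m.+1).
Proof.
move=> mn mi; rewrite /coef_c ltnNge mi /=; have -> : (m == n) = false by lia.
case: eqP => // ->; have -> : (n - n.-1 = 1)%N by lia.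
by rewrite expr1 mulN1r prednK //; lia.
Qed.

Lemma commute_X_boundary i : (0 < m < n)%N -> (m <= i <= n)%N -> ~~ Pi_l n m i ->
  rep (Uk_X n m q y i) * A = A * rep (Uk_X n m q y i).
Proof.
move=> hm0 hi' hPi; have hin : (0 < i <= n)%N by lia.
have loi : lo n i = m by apply: lo_notin_Pi_l; lia.
have hii : (m < hi n i < bar m)%N by rewrite /hi /Defs.bar; case: ifP; lia.
have hiN : (0 < hi n i <= N)%N by move: hii; rewrite /Defs.bar; lia.
have hib : (m < bar (hi n i) < bar m)%N by move: hii; rewrite /Defs.bar; lia.
(* The Cartan factor acts by [1] on row [m] and by [q^{-2}] on row [b'], with [b = hi n i]. The sign
   [(-1)^{n-m}] of [c] meets the sign [(-1)^{n-m-1}] of the commutator, which leaves [-1]. *)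
have -> : rep (Uk_X n m q y i) = munit K n m (hi n i)
    - q ^- 2 *: munit K n (bar (hi n i)) (bar m)
    + (- (y m * q ^+ m.+2)^-1) *: (munit K n (bar (hi n i)) m
        - (q ^+ (n - m).-1.*2)^-1 *: munit K n (bar m) (hi n i)).
  rewrite natural_rep_X //.
  rewrite natural_rep_tilde_F // nat_eE mulrBr !nat_diag_munit loi.
  rewrite weight_tilde_diff_hi ?weight_tilde_diff_fixed //; try lia.
  rewrite expr0z scale1r; congr (_ + _).
  rewrite /skew_unit barK //.
  rewrite -scalerA -scalerBr !scalerA coef_c_boundary; try lia.
  congr (_ *: _); have -> : (n - m = (n - m).-1.+1)%N by lia.
  rewrite exprS mulN1r !mulNr [q ^+ m.+2]exprS !invfM.
  have := sqrr_sign K (n - m).-1; rewrite expr2 => sq.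
  by ring: sq.
(* With [n - m = k + 1] all exponents become sums, and the remaining identities are ones that
   [field] can decide. *)
case kE: (n - m)%N => [|k]; first lia.
have nE : n = (m + k.+1)%N by lia.
have ym : y m != 0 by apply: y_neq0; lia.
apply: (@commute_twisted_pair _ _ _ _ _ _ _ _ _ _ _ (q ^- m)); try lia.
- by rewrite diag_A_mid.
- by rewrite diag_A_mid.
- by rewrite diag_A_high.
- by rewrite antidiag_A_mid.
- rewrite diag_A_low // antidiag_A_out ?leqnn // kE /= doubleS !exprS.
  by field; rewrite ?hq0 ?expf_neq0 ?ym.
- rewrite antidiag_A_out ?barK ?leqnn ?orbT ?y_barE; try lia.
  have -> : N = (m + m + k.*2.+2)%N by lia.
  rewrite /= !exprD !exprS.
  by field; rewrite ?hq0 ?expf_neq0 ?ym.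
- rewrite antidiag_A_out ?leqnn // !exprS.
  by field; rewrite ?hq0 ?expf_neq0 ?ym.
Qed.

Lemma commute_Uk_gen x : Uk_gen m y x -> rep x * A = A * rep x.
Proof.
have levi i : (0 < i <= n)%N -> Pi_l n m i ->
    (m < lo n i < bar m)%N /\ (m < hi n i < bar m)%N.
  by rewrite /Pi_l /lo /hi /Defs.bar; case: ifP; lia.
have flip j : (m < j < bar m)%N -> (m < bar j < bar m)%N.
  by rewrite /Defs.bar; lia.
have wt0 i j : (0 < i <= n)%N -> Pi_l n m i -> (0 < j <= m)%N ->
    nat_wt n i j = 0 /\ nat_wt n i (bar j) = 0.
  rewrite /Pi_l /nat_wt /Defs.bar => hi hP hj; case: ifP => ?; split; decide_eqs; lia.
case=> i hin hP.
- have [hl hh] := levi i hin hP; rewrite natural_rep_e // nat_eE.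
  by rewrite mulrBl mulrBr !commute_munit_levi ?flip.
- have [hl hh] := levi i hin hP; rewrite natural_rep_f // nat_fE.
  by rewrite mulrBl mulrBr !commute_munit_levi ?flip.
- rewrite natural_rep_k //; apply: commute_nat_diag => // j hj.
  by have [-> ->] := wt0 i j hin hP hj.
- rewrite natural_rep_kinv //; apply: commute_nat_diag => // j hj.
  by have [-> ->] := wt0 i j hin hP hj.
(* The second case has [m > 0], because for [m = 0] every node lies in [Pi_l]. *)
- have [h|h] : (i < m)%N || (m == n) && (i == n) \/ (0 < m < n)%N && (m <= i)%N.
  + by move: hP; rewrite /Pi_l; lia.
  + by apply: commute_X_reflexive => //; lia.
  by apply: commute_X_boundary => //; lia.
- rewrite natural_rep_qh; apply: commute_nat_diag => // j hj.
  rewrite weight_bar ?weight_tilde_diff_fixed ?oppr0 //; lia.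
- rewrite natural_rep_qh; apply: commute_nat_diag => // j hj.
  have wN k : weight n (fun j => - tilde_diff n m i j) k
      = - weight n (tilde_diff n m i) k.
    by rewrite /weight -sumrN; apply: eq_bigr => l _; rewrite mulNr.
  rewrite !wN weight_bar ?weight_tilde_diff_fixed ?oppr0 //; lia.
Qed.

Lemma commute_Uk x : Uk m y x -> rep x * A = A * rep x.
Proof.
elim=> [{}x /commute_Uk_gen //||u v _ IHu _ IHv|u v _ IHu _ IHv|c u _ IHu].
- by rewrite rmorph1 mul1r mulr1.
- by rewrite rmorphD mulrDl IHu IHv -mulrDr.
- by rewrite rmorphM -mulrA IHv mulrA IHu -mulrA.
- by rewrite [rep _](natural_repZ hn hq0 hq) mulmx_scalel mulmx_scaler IHu.
Qed.

End Invariance.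

Theorem mainTheorem7 (R : realType) (n m : nat) (q : R[i]) (y : nat -> R[i])
  (sgn : bool)
  (hn : (3 <= n)%N) (hq0 : q != 0) (hq : not_root_of_unity q)
  (hm : (m <= n)%N)
  (hy : forall i, (1 <= i <= n.*2)%N -> (i <= m)%N || (bar n i <= m)%N ->
        y i * y (bar n i) = q ^- n.*2)
  (A : 'M[R[i]]_(n.*2)) (hA : A = (-1) ^+ sgn *: mat_A n m q y) :
  forall x : Uq n q, Uk m y x ->
    natural_rep hn hq0 hq x *m A = A *m natural_rep hn hq0 hq x.
Proof.
move=> x Ux; rewrite hA -scalemxAr -scalemxAl; congr (_ *: _).
exact: (commute_Uk hn hq0 hq hm hy Ux).
Qed.
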